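(* Let $\Lambda$ be a $k$-graph, let $\Lambda_D$ be the $k$-graph obtained from $\Lambda$ by delaying an edge $f\in\Lambda^{e_1}$, and let $(\Lambda_D)_R$ be obtained by performing reduction (R) on the pair $(\Lambda_D,v_f)$ (with color set $B=\{e_1\}$). Then $(\Lambda_D)_R\cong\Lambda$ as $k$-graphs.
   Context: **$k$-graphs.** $0\in\mathbb N$; $E=\{e_1,\dots,e_k\}$ is the standard basis of $\mathbb N^k$, whose elements are called colors. A $k$-graph is a countable category $\Lambda$ with a functor $d:\Lambda\to\mathbb N^k$ such that for every $\lambda\in\Lambda$ and $m,n\in\mathbb N^k$ with $d(\lambda)=m+n$ there are unique $\mu,\nu\in\Lambda$ with $d(\mu)=m$, $d(\nu)=n$, $\lambda=\mu\nu$. Composition is from right to left. For $A\subseteq\mathbb N^k$, $\Lambda^A=\{\lambda:d(\lambda)\in A\}$, $\Lambda^n=\Lambda^{\{n\}}$; $\Lambda^0$ is the set of vertices (identified with objects) and $\Lambda^E$ the set of edges; $s,r$ are source and range; $w\Lambda^A=\{\lambda\in\Lambda^A:r(\lambda)=w\}$, $\Lambda^Av=\{\lambda\in\Lambda^A:s(\lambda)=v\}$, $w\Lambda^Av=w\Lambda^A\cap\Lambda^Av$. The 1-skeleton $G(\Lambda)$ is the directed graph $(\Lambda^0,\Lambda^E,s,r)$ with edges colored by $d$; $G(\Lambda)^*$ is its path category; for paths, $\mu\sim\nu$ means that $\mu$ and $\nu$ have the same composite in $\Lambda$, and $[\mu]$ is that composite. An isomorphism $\cong$ of $k$-graphs is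 a bijective degree-preserving functor. **Reducibility.** A vertex $w$ is reducible with color set $\emptyset\ne B\subseteq E$ if there is $v\in\Lambda^0$ such that: every $\mu\in w\Lambda^Ev$ has $d(\mu)\in B$; for all $b\in B$, $w\Lambda^b=\{f_b\}$ is a singleton; $w\notin r(\Lambda^Bw)$; and $s(w\Lambda^B)=\{v\}$. Put $\mathcal E=E\setminus B$. The neighborhood $U_w^{\mathcal E}$ is the (undirected) connected component containing $w$ of the subgraph of $G(\Lambda)$ with vertex set $\Lambda^0$ and edge set $\Lambda^{\mathcal E}$; $(U_w^{\mathcal E})^0$ and $(U_w^{\mathcal E})^E$ are its vertices and edges, and for a vertex $x$, $x\in U_w^{\mathcal E}$ means $x\in(U_w^{\mathcal E})^0$. $w$ is fully reducible with color set $B$ if each $x\in(U_w^{\mathcal E})^0$ is reducible with color set $B$ and $\big(\bigcup_{x\in (U_w^{\mathcal E})^0}\Lambda^Bx\big)\cap\big(\bigcup_{x\in (U_w^{\mathcal E})^0}x\Lambda^B\big)=\emptyset$. For $x\in(U_w^{\mathcal E})^0$ and $b\in B$, $f_{b,x}$ denotes the unique edge of color $b$ with range $x$. **Stationary.** A set $\mathcal F\subseteq\Lambda^E$ is stationary in color set $B$ if for all $f_1,f_2\in\mathcal F$: $s(f_1)=s(f_2)$ and $r(f_1)=r(f_2)$; if $\lambda\in\Lambda^Br(f_1)$ and $\lambda f_1\sim\nu\mu$ (with $\nu,\mu$ edges), then $\mu\in\mathcal F$; if $\lambda\in s(f_1)\Lambda^B$ and $f_1\lambda\sim\nu\mu$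 (with $\nu,\mu$ edges), then $\nu\in\mathcal F$. **Hypotheses $H_R$ (with color set $B$).** $w$ is fully reducible with color set $B$, and for every $x\in(U_w^{\mathcal E})^0$ the set $x\Lambda^B$ is stationary with color set $B$. (The pair $(\Lambda_D,v_f)$ below satisfies $H_R$ with color set $\{e_1\}$.) **Reduction (R).** For $(\Lambda,w)$ satisfying $H_R$, define a colored directed graph $G(\Lambda_R)$ by $\Lambda_R^0=\Lambda^0\setminus(U_w^{\mathcal E})^0$, $\Lambda_R^E=\Lambda^E\setminus\big((U_w^{\mathcal E})^E\cup\bigcup_{x\in(U_w^{\mathcal E})^0}x\Lambda^B\big)$, with edges keeping their colors, $r_R(\mu)=r(\mu)$, and $s_R(\mu)=s(f_{b,s(\mu)})$ if $s(\mu)\in U_w^{\mathcal E}$, $s_R(\mu)=s(\mu)$ otherwise. Let $\iota:\Lambda_R^E\to\Lambda^E$ be the inclusion. Fix $b\in B$. Define $\operatorname{par}$ on edges by $\operatorname{par}(\mu)=\iota(\mu)f_{b,s(\iota(\mu))}$ if $s(\iota(\mu))\in(U_w^{\mathcal E})^0$ and $\operatorname{par}(\mu)=\iota(\mu)$ otherwise, by the identity on vertices, and extend multiplicatively to paths. Define $\sim_R$ on $G(\Lambda_R)^*$: on vertices and edges it is equality; for paths $\mu,\nu$ of length at least 2, $\mu\sim_R\nu$ iff $\operatorname{par}(\mu)=\operatorname{par}(\nu)$ in $\Lambda$. Then $\Lambda_R=G(\Lambda_R)^*/\sim_R$ is a $k$-graph. **Delay (D).** Let $\Lambda$ be a $k$-graph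 and $f\in\Lambda^{e_1}$. Set $A_1=\{f\}\cup\{g\in\Lambda^{e_1}: ag\sim fb\text{ or }ga\sim bf\text{ for some }a,b\in\Lambda^{e_i},\ 2\le i\le k\}$, $A_m=\{e\in\Lambda^{e_1}: ag\sim eb\text{ or }ga\sim be\text{ for some }a,b\in\Lambda^{e_i},\ 2\le i\le k,\ g\in A_{m-1}\}$ for $m\ge2$, and $C^{e_1}=\bigcup_{j\ge1}A_j$. For $2\le i\le k$ let $C^{e_i}=\{[ga]\in\Lambda:g\in C^{e_1},a\in\Lambda^{e_i},\ s(g)=r(a)\}$. Introduce new edges $C_D^{e_1}=\{g^1,g^2:g\in C^{e_1}\}$ (color $e_1$) and $C_D^{e_i}=\{e_\alpha:\alpha\in C^{e_i}\}$ (color $e_i$), $2\le i\le k$, and new vertices $v_g$, $g\in C^{e_1}$. The colored graph $G_D$ has $\Lambda_D^0=\Lambda^0\sqcup\{v_g:g\in C^{e_1}\}$, $\Lambda_D^{e_1}=(\Lambda^{e_1}\setminus C^{e_1})\sqcup C_D^{e_1}$, $\Lambda_D^{e_i}=\Lambda^{e_i}\sqcup C_D^{e_i}$ for $i\ge2$; old edges keep source, range and color; $s_D(g^1)=s(g)$, $r_D(g^1)=v_g=s_D(g^2)$, $r_D(g^2)=r(g)$; and for $\alpha=[bg]=[ha]\in C^{e_i}$ with $g,h$ of degree $e_1$ and $a,b$ of degree $e_i$, $s_D(e_\alpha)=v_g$, $r_D(e_\alpha)=v_h$. The relation $\sim_D$ on two-colored paths of length 2 in $G_D$ is: (Case 1)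 for paths of two old edges, $\sim_D$ is the relation inherited from $\Lambda$; (Case 2) whenever $bg\sim ha$ in $\Lambda$ with $g,h\in C^{e_1}$ and $a,b\in\Lambda^{e_i}$, $i\geq 2$: $b\,g^2\sim_D h^2e_{[bg]}$ and $e_{[bg]}g^1\sim_D h^1a$; (Case 3) let $e_\beta e_\alpha$ be a path with $\alpha\in C^{e_i}$, $\beta\in C^{e_j}$, $i\ne j$; write $\alpha=[ga]$ and $\beta=[cg]=[hc']$ with $g,h\in C^{e_1}$, $a\in\Lambda^{e_i}$, $c,c'\in\Lambda^{e_j}$, and consider the 3-cube in $\Lambda$ determined by $cga=hc'a$: factor $c'a=a'c''$ with $d(a')=e_i$, $d(c'')=e_j$, and $ha'=b'g_1$ with $d(b')=e_i$, $d(g_1)=e_1$; put $\gamma=[ha']\in C^{e_i}$ (the face opposite $\alpha$) and $\delta=[g_1c'']\in C^{e_j}$ (the face opposite $\beta$); then $e_\beta e_\alpha\sim_De_\gamma e_\delta$. $\Lambda_D$ is the $k$-graph obtained as the quotient of the path category $G_D^*$ by the equivalence relation $\sim_D$ that these squares generate compatibly with concatenation. *)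

(* Defs.v *)
From HB Require Import structures.
From mathcomp Require Import all_boot all_order all_algebra generic_quotient.
From mathcomp Require Import boolp classical_sets functions cardinality.
From Stdlib Require Import Relation_Operators.

Set Implicit Arguments.
Unset Strict Implicit.
Unset Printing Implicit Defensive.

Import GRing.Theory.

Local Open Scope quotient_scope.
Local Open Scope classical_set_scope.
Local Open Scope ring_scope.

Notation degree k := {ffun 'I_k -> nat}.

(* The colors are the basis vectors themselves, as elements of N^k; the vector
   that is usually called e_1 is [e_ ord0]. *)
Definition e_ k (i : 'I_k) : degree k := [ffun j => (j == i : nat)].
Definition colors k : set (degree k) := range (@e_ k).

(* The data of a (small) category with a degree map.  Vertices (objects) and
   morphisms are separate types, linked by [idm].  [comp mu nu] is "mu after
   nu"; it is meaningful only when [src mu = rng nu], and nothing is ever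
   required of its value on other pairs. *)
Record kdata (k : nat) := KData {
  vert : Type;
  mor : Type;
  src : mor -> vert;
  rng : mor -> vert;
  idm : vert -> mor;
  comp : mor -> mor -> mor;
  deg : mor -> degree k
}.

Record is_kgraph k (L : kdata k) : Prop := IsKGraph {
  src_idm : forall v : vert L, src (idm v) = v;
  rng_idm : forall v : vert L, rng (idm v) = v;
  src_comp : forall l m : mor L, src l = rng m -> src (comp l m) = src m;
  rng_comp : forall l m : mor L, src l = rng m -> rng (comp l m) = rng l;
  comp_idl : forall l : mor L, comp (idm (rng l)) l = l;
  comp_idr : forall l : mor L, comp l (idm (src l)) = l;
  compA : forall l m n : mor L, src l = rng m -> src m = rng n ->
    comp l (comp m n) = comp (comp l m) n;
  deg_idm : forall v : vert L, deg (idm v) = 0;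
  deg_comp : forall l m : mor L, src l = rng m ->
    deg (comp l m) = deg l + deg m;
  countable_mor : countable [set: mor L];
  factorization : forall (l : mor L) (m n : degree k), deg l = m + n ->
    exists! p : mor L * mor L,
      [/\ deg p.1 = m, deg p.2 = n, src p.1 = rng p.2 & l = comp p.1 p.2]
}.

Record kgraph (k : nat) := KGraph {
  kgraph_data :> kdata k;
  kgraphP : is_kgraph kgraph_data
}.

Definition kgraph_iso k (L M : kdata k) : Prop :=
  exists (F0 : vert L -> vert M) (F : mor L -> mor M),
  [/\ bijective F0 /\ bijective F,
      (forall l, src (F l) = F0 (src l)) /\ (forall l, rng (F l) = F0 (rng l)),
      forall v, F (idm v) = idm (F0 v),
      forall l m, src l = rng m -> F (comp l m) = comp (F l) (F m)
    & forall l, deg (F l) = deg l].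

Section Morphisms.
Variables (k : nat) (L : kdata k).
Implicit Types (A : set (degree k)) (v w : vert L) (a b c d : mor L).

Definition mors A : set (mor L) := @deg k L @^-1` A.
Definition into w A : set (mor L) := mors A `&` [set l | rng l = w].
Definition from A v : set (mor L) := mors A `&` [set l | src l = v].

(* The length two paths [a b] and [c d] have the same composite. *)
Definition sim2 a b c d : Prop :=
  [/\ src a = rng b, src c = rng d & comp a b = comp c d].

End Morphisms.
Arguments mors {k} L A.

(** * Path categories of colored graphs and their quotients *)

Record cgraph (k : nat) := CGraph {
  gvert : Type;
  gedge : Type;
  gsrc : gedge -> gvert;
  grng : gedge -> gvert;
  gcolor : gedge -> degree k
}.

Section Paths.
Variables (k : nat) (Q : cgraph k).

Fixpoint is_walk (v : gvert Q) (s : seq (gedge Q)) : Prop :=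
  if s is e :: s' then grng e = v /\ is_walk (gsrc e) s' else True.

(* The path with edge sequence [:: x1; ...; xn] is x1 x2 ... xn, where the
   source of each edge is the range of the next one; hence the first edge is
   the one at the range of the path. *)
Record gpath := GPath {
  prng : gvert Q;
  pseq : seq (gedge Q);
  pwalk : is_walk prng pseq
}.

HB.instance Definition _ := gen_eqMixin gpath.
HB.instance Definition _ := gen_choiceMixin gpath.

Definition psrc (p : gpath) : gvert Q := last (prng p) (map (@gsrc k Q) (pseq p)).
Definition pdeg (p : gpath) : degree k := \sum_(x <- pseq p) gcolor x.
Definition pid (v : gvert Q) : gpath := @GPath v [::] I.

Lemma walk_cat v s t : is_walk v s ->
  is_walk (last v (map (@gsrc k Q) s)) t -> is_walk v (s ++ t).
Proof. by elim: s v => [|e s IH] v //= [-> ws] wt; split=> //; apply: IH. Qed.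

Lemma pcomp_walk (p q : gpath) : psrc p = prng q ->
  is_walk (prng p) (pseq p ++ pseq q).
Proof. by move=> pq; apply: walk_cat (pwalk p) _; rewrite -/(psrc p) pq; apply: pwalk. Qed.

Definition pcomp (p q : gpath) : gpath :=
  if pselect (psrc p = prng q) is left pq then GPath (pcomp_walk pq) else p.

Inductive gen_cong (S : seq (gedge Q) -> seq (gedge Q) -> Prop) :
    gpath -> gpath -> Prop :=
| GenSquare p q : S (pseq p) (pseq q) -> gen_cong S p q
| GenRefl p : gen_cong S p p
| GenSym p q : gen_cong S p q -> gen_cong S q p
| GenTrans p q r : gen_cong S p q -> gen_cong S q r -> gen_cong S p r
| GenComp p p' q q' : psrc p = prng q -> psrc p' = prng q' ->
    gen_cong S p p' -> gen_cong S q q' -> gen_cong S (pcomp p q) (pcomp p' q').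

Lemma gen_cong_equiv S : equiv_class_of (fun p q => `[< gen_cong S p q >]).
Proof.
split.
- by move=> p; apply/asboolP/GenRefl.
- by move=> p q; apply/asboolP/asboolP => /GenSym.
- by move=> q p r /asboolP pq /asboolP qr; apply/asboolP; exact: GenTrans pq qr.
Qed.
Definition gen_cong_rel S := EquivRelPack (gen_cong_equiv S).

(* Source, range and degree of a class, and composites, are computed on
   representatives. *)
Definition path_quotient (R : equiv_rel gpath) : kdata k := {|
  vert := gvert Q;
  mor := {eq_quot R};
  src := fun c => psrc (repr c);
  rng := fun c => prng (repr c);
  idm := fun v => \pi_{eq_quot R} (pid v);
  comp := fun c d => \pi_{eq_quot R} (pcomp (repr c) (repr d));
  deg := fun c => pdeg (repr c)
|}.

End Paths.

(** * Reduction *)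

Section Reducible.
Variables (k : nat) (L : kdata k).
Implicit Types (B : set (degree k)) (w x : vert L).

Definition reducible w B : Prop :=
  [/\ B !=set0, B `<=` @colors k &
  exists v : vert L,
   [/\ forall mu, into w (@colors k) mu -> from (@colors k) v mu -> mors L B mu,
       forall b, B b -> exists f, into w [set b] = [set f],
       ~ (@rng k L @` from B w) w
     & @src k L @` into w B = [set v]]].

Section Neighborhood.
Variables (w : vert L) (B : set (degree k)).
Let EB : set (degree k) := @colors k `\` B.

Definition adjacent x y : Prop := exists2 l, mors L EB l & src l = x /\ rng l = y.

Definition nbhd_vert : set (vert L) := clos_refl_sym_trans (vert L) adjacent w.
Definition nbhd_edge : set (mor L) :=
  mors L EB `&` [set l | nbhd_vert (src l) /\ nbhd_vert (rng l)].
End Neighborhood.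

Definition fully_reducible w B : Prop :=
  (forall x, nbhd_vert w B x -> reducible x B) /\
  (\bigcup_(x in nbhd_vert w B) from B x) `&`
  (\bigcup_(x in nbhd_vert w B) into x B) = set0.

Definition stationary B (F : set (mor L)) : Prop :=
  F `<=` mors L (@colors k) /\
  forall f1 f2, F f1 -> F f2 ->
   [/\ src f1 = src f2, rng f1 = rng f2,
       forall l nu mu, from B (rng f1) l ->
         mors L (@colors k) nu -> mors L (@colors k) mu ->
         sim2 l f1 nu mu -> F mu
     & forall l nu mu, into (src f1) B l ->
         mors L (@colors k) nu -> mors L (@colors k) mu ->
         sim2 f1 l nu mu -> F nu].

Definition HR w B : Prop :=
  fully_reducible w B /\
  forall x, nbhd_vert w B x -> stationary B (into x B).

End Reducible.

Section Reduction.
Variables (k : nat) (L : kdata k) (w : vert L) (B : set (degree k)).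
Hypothesis hR : HR w B.
Variables (b : degree k) (Bb : B b).

Local Notation U := (nbhd_vert w B).

Lemma unique_edge x : U x -> exists f, into x [set b] = [set f].
Proof. by move=> Ux; case: hR => -[/(_ x Ux)[_ _ [v [_ /(_ b Bb)]]]]. Qed.

(* The edge f_{b,x}. *)
Definition f_ x (Ux : U x) : mor L := projT1 (cid (unique_edge Ux)).

Lemma f_P x (Ux : U x) : into x [set b] (f_ Ux).
Proof. by rewrite /f_; case: cid => f /= ->. Qed.

Definition R_vert := set_type (~` U).
Definition R_edge := set_type
  (mors L (@colors k) `\` (nbhd_edge w B `|` \bigcup_(x in U) into x B)).

Lemma f_src_notin x (Ux : U x) : src (f_ Ux) \in ~` U.
Proof.
rewrite in_setE => /= Us; have [fb fx] := f_P Ux.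
have fB : mors L B (f_ Ux) by rewrite /mors /= [deg _]fb.
case: hR => -[_ disj] _.
suff : set0 (f_ Ux) by [].
by rewrite -disj; split; [exists (src (f_ Ux)) | exists x].
Qed.

Lemma R_rng_notin (m : R_edge) : rng (val m) \in ~` U.
Proof.
rewrite in_setE => /= Ur; case: (set_valP m) => mE []; set l := val m.
have [lB|lB] := pselect (mors L B l); first by right; exists (rng l).
have lEB : mors L (@colors k `\` B) l by split.
left; split=> //; split=> //; apply: rst_trans Ur _.
by apply: rst_sym; apply: rst_step; exists l.
Qed.

Definition R_src (m : R_edge) : R_vert :=
  match pselect (U (src (val m))) with
  | left Us => SigSub (f_src_notin Us)
  | right nUs => SigSub (mem_set (nUs : (~` U) _))
  end.

Definition R_graph : cgraph k := {|
  gvert := R_vert;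
  gedge := R_edge;
  gsrc := R_src;
  grng := fun m => SigSub (R_rng_notin m);
  gcolor := fun m => deg (val m)
|}.

Definition par_edge (m : R_edge) : mor L :=
  match pselect (U (src (val m))) with
  | left Us => comp (val m) (f_ Us)
  | right _ => val m
  end.

(* The composite in [L] of the path par(p). *)
Definition par (p : gpath R_graph) : mor L :=
  foldr (fun m l => comp (par_edge m) l) (idm (val (psrc p))) (pseq p).

Definition R_sim (p q : gpath R_graph) : Prop :=
  if (1 < size (pseq p))%N && (1 < size (pseq q))%N then par p = par q
  else p = q.

Lemma R_sim_equiv : equiv_class_of (fun p q => `[< R_sim p q >]).
Proof.
rewrite /R_sim; split.
- by move=> p; apply/asboolP; case: ifP.
- by move=> p q; apply/asboolP/asboolP; rewrite andbC; case: ifP => _ ->.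
- move=> q p r /asboolP pq /asboolP qr; apply/asboolP; move: pq qr.
  have [p1|p1] := ltnP 1%N (size (pseq p)); have [q1|q1] := ltnP 1%N (size (pseq q));
    have [r1|r1] := ltnP 1%N (size (pseq r)) => //= pq qr; subst=> //.
  - by rewrite pq.
  - by move: r1; rewrite leqNgt q1.
  - by move: p1; rewrite leqNgt q1.
Qed.

Definition reduction : kdata k := path_quotient (EquivRelPack R_sim_equiv).

End Reduction.

(** * Delay *)

Lemma e_inj k : injective (@e_ k).
Proof.
move=> i j /ffunP/(_ i); rewrite !ffunE eqxx.
by case: eqP.
Qed.

Lemma e_neq0 k (i : 'I_k) : e_ i <> 0.
Proof. by move/ffunP/(_ i); rewrite !ffunE eqxx. Qed.

Lemma e_addl k (i j : 'I_k) (d : degree k) : e_ i + d = e_ j -> d = 0.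
Proof.
move=> /ffunP H; apply/ffunP => l.
have := H l; have := H i; rewrite !ffunE eqxx.
case: (i =P j) => [->|_ /=]; last by [].
by move=> _; case: (l == j) => /= [[]|].
Qed.


Section Delay.
Variables (k : nat) (L : kgraph k.+1) (f : mor L).
Hypothesis deg_f : deg f = e_ ord0.

Local Notation e1 := (e_ (ord0 : 'I_k.+1)).
(* As [i] ranges over ['I_k], the colors other than e_1. *)
Local Notation e' i := (e_ (lift ord0 i)).

Definition across (g e : mor L) : Prop :=
  exists (i : 'I_k) (a b : mor L),
    [/\ deg a = e' i, deg b = e' i & sim2 a g e b \/ sim2 g a b e].

(* [A_ m] is the set A_{m+1}. *)
Fixpoint A_ (m : nat) : set (mor L) :=
  if m is m'.+1 then
    [set e | deg e = e1 /\ exists2 g, A_ m' g & across g e]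
  else [set f] `|` [set g | deg g = e1 /\ across g f].

Definition C1 : set (mor L) := \bigcup_m A_ m.
Definition C_ (i : 'I_k) : set (mor L) :=
  [set l | exists g a, [/\ C1 g, deg a = e' i, src g = rng a & l = comp g a]].

Lemma C1_f : C1 f.
Proof. by exists 0%N => //; left. Qed.

Lemma C1_deg g : C1 g -> deg g = e1.
Proof. by case=> -[|m] _ /= => [[->|[]]|[]]. Qed.

Lemma C1_across g e : C1 g -> across g e -> deg e = e1 -> C1 e.
Proof. by move=> [m _ Ag] ge de; exists m.+1 => //; split=> //; exists g. Qed.

Lemma C_range i (al : set_type (C_ i)) : exists h : set_type C1,
  exists a, [/\ deg a = e' i, src (val h) = rng a & val al = comp (val h) a].
Proof.
have [h [a [Ch da ha ->]]] := set_valP al.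
by exists (SigSub (mem_set Ch)), a.
Qed.

Lemma C_source i (al : set_type (C_ i)) : exists g : set_type C1,
  exists b, [/\ deg b = e' i, src b = rng (val g) & val al = comp b (val g)].
Proof.
have [h [a [Ch da ha alE]]] := set_valP al.
have dal : deg (val al) = e' i + e1.
  by rewrite alE (deg_comp (kgraphP L)) // da (C1_deg Ch) addrC.
have [[b g] [[/= db dg bg bgE] _]] := factorization (kgraphP L) dal.
suff Cg : C1 g by exists (SigSub (mem_set Cg)), b.
apply: C1_across Ch _ dg; exists i, a, b; split=> //; right.
by split=> //; rewrite -alE.
Qed.

Definition D_vert : Type := vert L + set_type C1.

Definition D_old := set_type (mors L (@colors k.+1) `\` C1).

(* [Fst g], [Snd g] and [New al] are the edges g^1, g^2 and e_al. *)
Inductive D_edge : Type :=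
| Old of D_old
| Fst of set_type C1
| Snd of set_type C1
| New (i : 'I_k) of set_type (C_ i).

Definition D_src (x : D_edge) : D_vert :=
  match x with
  | Old a => inl (src (val a))
  | Fst g => inl (src (val g))
  | Snd g => inr g
  | New i al => inr (projT1 (cid (C_source al)))
  end.

Definition D_rng (x : D_edge) : D_vert :=
  match x with
  | Old a => inl (rng (val a))
  | Fst g => inr g
  | Snd g => inl (rng (val g))
  | New i al => inr (projT1 (cid (C_range al)))
  end.

Definition D_color (x : D_edge) : degree k.+1 :=
  match x with
  | Old a => deg (val a)
  | Fst _ | Snd _ => e1
  | New i _ => e' i
  end.

Definition D_graph : cgraph k.+1 :=
  {| gvert := D_vert; gedge := D_edge;
     gsrc := D_src; grng := D_rng; gcolor := D_color |}.

Inductive D_square : seq D_edge -> seq D_edge -> Prop :=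
| D_case1 (x y z t : D_old) :
    deg (val x) <> deg (val y) -> deg (val z) <> deg (val t) ->
    sim2 (val x) (val y) (val z) (val t) ->
    D_square [:: Old x; Old y] [:: Old z; Old t]
| D_case2_snd (i : 'I_k) (g h : set_type C1) (a b : D_old)
    (al : set_type (C_ i)) :
    deg (val a) = e' i -> deg (val b) = e' i ->
    sim2 (val b) (val g) (val h) (val a) -> val al = comp (val b) (val g) ->
    D_square [:: Old b; Snd g] [:: Snd h; New al]
| D_case2_fst (i : 'I_k) (g h : set_type C1) (a b : D_old)
    (al : set_type (C_ i)) :
    deg (val a) = e' i -> deg (val b) = e' i ->
    sim2 (val b) (val g) (val h) (val a) -> val al = comp (val b) (val g) ->
    D_square [:: New al; Fst g] [:: Fst h; Old a]
| D_case3 (i j : 'I_k) (al ga : set_type (C_ i)) (be de : set_type (C_ j))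
    (g h g1 : set_type C1) (a a' b' c c' c'' : mor L) :
    i != j ->
    deg a = e' i -> src (val g) = rng a -> val al = comp (val g) a ->
    deg c = e' j -> deg c' = e' j ->
    sim2 c (val g) (val h) c' -> val be = comp c (val g) ->
    deg a' = e' i -> deg c'' = e' j -> sim2 c' a a' c'' ->
    deg b' = e' i -> sim2 (val h) a' b' (val g1) ->
    val ga = comp (val h) a' -> val de = comp (val g1) c'' ->
    D_square [:: New be; New al] [:: New ga; New de].

Definition delay : kdata k.+1 := path_quotient (gen_cong_rel (Q := D_graph) D_square).

(* The vertex v_f. *)
Definition v_f : vert delay := inr (SigSub (mem_set C1_f)) : D_vert.

Lemma D_color_e (x : D_edge) : exists i, D_color x = e_ i.
Proof.
by case: x => [a|g|g|i al] /=; [case: (set_valP a) => -[i _ <-] _; exists i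
  | exists ord0 | exists ord0 | exists (lift ord0 i)].
Qed.

(* The edges of [delay] are the classes of the edges of [D_graph]. *)
Lemma D_one_edge (p : gpath D_graph) j : pdeg p = e_ j ->
  exists x : D_edge, [/\ pseq p = [:: x], D_color x = e_ j,
    prng p = D_rng x & psrc p = D_src x].
Proof.
case: p => r [|x s] w; rewrite /pdeg /psrc /= ?big_nil ?big_cons.
  by move=> /esym/e_neq0.
have [i xi] := D_color_e x; rewrite xi => H.
have := e_addl H; move: w H; case: s => [|y s] /= [rx _].
  by rewrite big_nil addr0 => H _; exists x; rewrite xi.
have [l yl] := D_color_e y; rewrite big_cons yl => _ H.
have: (e_ l + \sum_(z <- s) D_color z) l = 0%N by rewrite H ffunE.
by rewrite !ffunE eqxx.
Qed.

Definition all_e1 (p : gpath D_graph) : bool :=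
  all (fun x => D_color x == e1) (pseq p).

Lemma e'_neq (i : 'I_k) : (e' i == e1) = false.
Proof. by apply/eqP => /e_inj. Qed.

Lemma gpath_eq (Q : cgraph k.+1) (p q : gpath Q) :
  prng p = prng q -> pseq p = pseq q -> p = q.
Proof.
case: p q => [v s w] [v' s' w'] /= vv ss; move: w'; rewrite -vv -ss => w'.
by congr GPath; exact: Prop_irrelevance.
Qed.

Lemma gen_cong_e1 (p q : gpath D_graph) : gen_cong (Q := D_graph) D_square p q ->
  all_e1 p || all_e1 q -> p = q.
Proof.
have all_comp (p1 q1 : gpath D_graph) : psrc p1 = prng q1 ->
    all_e1 (pcomp p1 q1) -> all_e1 p1 /\ all_e1 q1.
  move=> pq1; rewrite /pcomp; case: pselect => // e.
  by rewrite /all_e1 /= all_cat => /andP.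
elim=> {p q} [p q||p q _ IH|p q r _ IH1 _ IH2|p p' q q' pq pq' _ IH1 _ IH2] //.
- rewrite /all_e1 => -[x y z t xy zt _|i g h a b al da db _ _|i g h a b al da db _ _
    |i j al ga be de g h g1 a a' b' c c' c'' _ _ _ _ _ _ _ _ _ _ _ _ _ _ _] /=;
  rewrite ?e'_neq ?da ?db ?e'_neq ?andbF //.
  by move=> /orP[] /and3P[/eqP h1 /eqP h2 _]; [case: xy|case: zt]; rewrite h1 h2.
- by rewrite orbC => /IH.
- case/orP=> h.
  + have pq : p = q by apply: IH1; rewrite h.
    by rewrite pq; apply: IH2; rewrite -pq h.
  + have qr : q = r by apply: IH2; rewrite h orbT.
    by rewrite -qr; apply: IH1; rewrite qr h orbT.
- case/orP => /all_comp[] // h1 h2.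
  + have -> : p = p' by apply: IH1; rewrite h1.
    by have -> : q = q' by apply: IH2; rewrite h2.
  + have -> : p = p' by apply: IH1; rewrite h1 orbT.
    by have -> : q = q' by apply: IH2; rewrite h2 orbT.
Qed.

Local Notation B1 := ([set e1] : set (degree k.+1)).
Local Notation cls := (\pi_{eq_quot (gen_cong_rel (Q := D_graph) D_square)}).

Lemma cls_eq (p q : gpath D_graph) : cls p = cls q ->
  gen_cong (Q := D_graph) D_square p q.
Proof. by move=> /eqmodP/asboolP. Qed.

Lemma repr_cls (p : gpath D_graph) : all_e1 p -> repr (cls p) = p.
Proof.
by move=> h; apply/gen_cong_e1; [apply/cls_eq; rewrite reprK | rewrite h orbT].
Qed.

Definition fst_path (g : set_type C1) : gpath D_graph :=
  @GPath _ D_graph (D_rng (Fst g)) [:: Fst g] (conj erefl I).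
Definition fst_mor (g : set_type C1) : mor delay := cls (fst_path g).

Lemma fst_e1 g : all_e1 (fst_path g).
Proof. by rewrite /all_e1 /= eqxx. Qed.

Lemma fst_deg g : deg (fst_mor g) = e1.
Proof. by rewrite /= repr_cls ?fst_e1 // /pdeg /= big_seq1. Qed.
Lemma fst_rng g : rng (fst_mor g) = inr g.
Proof. by rewrite /= repr_cls ?fst_e1. Qed.
Lemma fst_src g : src (fst_mor g) = inl (src (val g)).
Proof. by rewrite /= repr_cls ?fst_e1. Qed.

Lemma delay_edge (c : mor delay) : mors delay (@colors k.+1) c ->
  exists x : D_edge, [/\ pseq (repr c) = [:: x], deg c = D_color x,
    rng c = D_rng x & src c = D_src x].
Proof.
case=> j _ /esym dc; have [x [sx cx rx sx']] := D_one_edge dc.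
by exists x; split=> //; rewrite dc cx.
Qed.

Lemma B1_colors : B1 `<=` @colors k.+1.
Proof. by move=> _ ->; exists ord0. Qed.

Lemma edge_into_v (c : mor delay) g : into (inr g : vert delay) B1 c ->
  c = fst_mor g.
Proof.
move=> [cB cr]; have [x [sx dx rx _]] := delay_edge (B1_colors cB).
have xc : D_color x = e1 by rewrite -dx.
have rx' : D_rng x = inr g by rewrite -rx.
rewrite -[c]reprK; congr cls; apply: gpath_eq; first exact: cr.
rewrite sx; case: x xc rx' {sx dx rx} => //= [g' _ [->] //|i al /eqP].
by rewrite e'_neq.
Qed.

Lemma fst_into g : into (inr g : vert delay) B1 (fst_mor g).
Proof. by split; [exact: fst_deg | exact: fst_rng]. Qed.

Definition is_new (x : D_vert) : bool := if x is inr _ then true else false.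

Lemma nbhd_new (x : vert delay) : nbhd_vert v_f B1 x -> is_new x.
Proof.
move=> /= H; suff: is_new (v_f : D_vert) = is_new x by [].
elim: H => {x} [x y [l [lE ln] [<- <-]]|//|x y _ -> //|x y z _ -> _ -> //].
have [u [_ du ru su]] := delay_edge lE.
rewrite [rng _]ru [src _]su; case: u du {ru su} => //= g; case: ln; rewrite /= du.
Qed.

Lemma HR_delay : HR v_f B1.
Proof.
have newE (x : vert delay) : nbhd_vert v_f B1 x -> exists g, x = inr g.
  by move/nbhd_new; case: x => // g _; exists g.
have intoE g : into (inr g : vert delay) B1 = [set fst_mor g].
  by apply/seteqP; split=> [c /edge_into_v //|_ ->]; exact: fst_into.
split; [split|].
- move=> _ /newE[g ->]; split; first by exists e1.
    exact: B1_colors.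
  exists (inl (src (val g))); split.
  + move=> mu [mE mr] [_ ms]; have [x [_ dx rx sx]] := delay_edge mE.
    suff : D_color x = e1 by rewrite -dx.
    have {rx} : D_rng x = inr g by rewrite -rx; exact: mr.
    have {sx} : D_src x = inl (src (val g)) by rewrite -sx; exact: ms.
    by case: x {dx}.
  + by move=> _ ->; exists (fst_mor g).
  + move=> [c [cB cs] cr]; have cE : c = fst_mor g by apply: edge_into_v.
    have : src c = inr g by exact: cs.
    by rewrite cE fst_src.
  + by rewrite intoE image_set1 fst_src.
- rewrite -subset0 => c [[x /newE[g ->] [_ cs]] [y /newE[h ->] ch]].
  have : src c = inr g by exact: cs.
  by rewrite (edge_into_v ch) fst_src.
- move=> _ /newE[g ->]; rewrite intoE; split=> [_ ->|_ _ -> ->].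
    by apply: B1_colors; exact: fst_deg.
  have repr_fst : repr (fst_mor g) = fst_path g by rewrite repr_cls ?fst_e1.
  have two (c d nu mu : mor delay) : deg c = e1 -> deg d = e1 ->
      mors delay (@colors k.+1) nu -> mors delay (@colors k.+1) mu ->
      sim2 c d nu mu -> pseq (repr nu) = pseq (repr c) /\ pseq (repr mu) = pseq (repr d).
    move=> dc dd /delay_edge[x [sx _ _ _]] /delay_edge[y [sy _ _ _]].
    have [u [su cu _ _]] := D_one_edge dc; have [v [sv cv _ _]] := D_one_edge dd.
    case=> cd nm /cls_eq/gen_cong_e1; rewrite /pcomp.
    case: pselect => // h1; case: pselect => // h2.
    move=> eq_cd; have /eq_cd/(congr1 (@pseq _ _)) : all_e1 (GPath (pcomp_walk h1))
        || all_e1 (GPath (pcomp_walk h2)).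
      by rewrite /all_e1 /= su sv /= cu cv eqxx.
    by rewrite /= su sv sx sy => -[-> ->].
  have deg_e1 c : mors delay B1 c -> deg c = e1 by [].
  split=> // l nu mu [/deg_e1 ld lv] nE mE S.
  + have [_ sm] := two _ _ _ _ ld (fst_deg g) nE mE S.
    have [y [sy dy ry _]] := delay_edge mE.
    rewrite -intoE; move: sm; rewrite repr_fst sy => -[yE].
    by split; [apply: etrans dy _ | apply: etrans ry _]; rewrite yE.
  + have [sm _] := two _ _ _ _ (fst_deg g) ld nE mE S.
    have [y [sy dy ry _]] := delay_edge nE.
    rewrite -intoE; move: sm; rewrite repr_fst sy => -[yE].
    by split; [apply: etrans dy _ | apply: etrans ry _]; rewrite yE.
Qed.

End Delay.

(* Main.v *)
Require Import Defs.
From mathcomp Require Import all_boot all_algebra generic_quotient.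
From mathcomp Require Import boolp classical_sets functions.
From Stdlib Require Import Relation_Operators.

(** Collapsing each [v_g] to [s(g)] gives a functor from the delayed graph to
    [L]: [g^1] goes to the identity of [s(g)], [g^2] to [g], and [e_al], for
    [al = h a] with [h] in [C1], to [a].  It does not preserve degrees, but it is
    well defined because it respects the three kinds of squares.  The neighborhood
    of [v_f] consists of all the [v_g], so the edges of the reduction are the old
    edges and the [g^2], which the functor puts in bijection with the edges of
    [L]; moreover it sends par of a path to the composite in [L] of the
    corresponding edges.  Hence paths with equal par have equal composites.
    Conversely, paths of edges with equal composites in [L] differ by a sequence
    of commuting squares, and par sends each square of [L] to a composite of
    squares of the delayed graph. *)

Set Implicit Arguments.
Unset Strict Implicit.
Unset Printing Implicit Defensive.

Import GRing.Theory.

Local Open Scope quotient_scope.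
Local Open Scope classical_set_scope.
Local Open Scope ring_scope.

Local Notation comp := Defs.comp.
Local Notation pcomp := Defs.pcomp.
Local Notation compA := Defs.compA.

(** * Paths and their composites *)

Section Kgraph.
Variables (k : nat) (L : kgraph k).
Implicit Types (l m x y : mor L).

Lemma factor_ex l (m n : degree k) : deg l = m + n -> exists x y,
  [/\ deg x = m, deg y = n, src x = rng y & l = comp x y].
Proof.
by move=> /(factorization (kgraphP L))[[x y] [[/= dx dy xy lE] _]]; exists x, y.
Qed.

(** Cancellation in N^k gives [y] and [y'] the same degree, so uniqueness of factorizations applies
    to both pairs at once. *)
Lemma factor_inj x y x' y' : src x = rng y -> src x' = rng y' ->
  deg x = deg x' -> comp x y = comp x' y' -> x = x' /\ y = y'.
Proof.
move=> xy xy' dx E.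
have := deg_comp (kgraphP L) xy => D.
have D' : deg y' = deg y.
  have : deg x + deg y' = deg x + deg y.
    by rewrite -D E (deg_comp (kgraphP L) xy') dx.
  by move=> /ffunP H; apply/ffunP => i; have := H i; rewrite !ffunE => /addnI.
have [p [_ U]] := factorization (kgraphP L) D.
have p1 : p = (x, y) by apply: U.
have : p = (x', y') by apply: U; split.
by rewrite p1 => -[].
Qed.

(** Composing [l] with the identity at either end gives two factorizations of [l] into morphisms of
    degree 0, and these must agree. *)
Lemma deg0_idm l : deg l = 0 -> l = idm (rng l).
Proof.
move=> dl; have K := kgraphP L.
by have [] := @factor_inj l (idm (src l)) (idm (rng l)) l;
  rewrite ?src_idm ?rng_idm ?deg_idm ?comp_idl ?comp_idr.
Qed.

End Kgraph.

(** * Congruences generated by squares, and their quotient categories *)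

Section GenCong.
Variables (k : nat) (Q : cgraph k).
Implicit Types (p q : gpath Q) (S : seq (gedge Q) -> seq (gedge Q) -> Prop).

Lemma gpath_eqP p q : prng p = prng q -> pseq p = pseq q -> p = q.
Proof.
case: p q => [v s w] [v' s' w'] /= vv ss; move: w'; rewrite -vv -ss => w'.
by congr GPath; exact: Prop_irrelevance.
Qed.

Lemma prng_pcomp p q : prng (pcomp p q) = prng p.
Proof. by rewrite /pcomp; case: pselect. Qed.

Lemma pseq_pcomp p q : psrc p = prng q ->
  pseq (pcomp p q) = pseq p ++ pseq q.
Proof. by rewrite /pcomp; case: pselect. Qed.

Lemma psrc_pcomp p q : psrc p = prng q -> psrc (pcomp p q) = psrc q.
Proof.
move=> pq; rewrite /psrc pseq_pcomp // prng_pcomp map_cat last_cat.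
by rewrite -/(psrc p) pq.
Qed.

Lemma pcompA p q r : psrc p = prng q -> psrc q = prng r ->
  pcomp p (pcomp q r) = pcomp (pcomp p q) r.
Proof.
move=> pq qr; apply: gpath_eqP; first by rewrite !prng_pcomp.
by rewrite !pseq_pcomp ?psrc_pcomp ?prng_pcomp // catA.
Qed.

Definition edge_path (x : gedge Q) : gpath Q :=
  @GPath _ Q (grng x) [:: x] (conj erefl I).

Lemma gpath_cons p x s : pseq p = x :: s -> exists q,
  [/\ pseq q = s, gsrc x = prng q & p = pcomp (edge_path x) q].
Proof.
case: p => v t w /= E; move: w; rewrite E => -[xv w].
exists (GPath w); split=> //.
by apply: gpath_eqP; rewrite ?prng_pcomp // pseq_pcomp.
Qed.

Lemma gpath_two p x y : pseq p = [:: x; y] ->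
  gsrc x = grng y /\ p = pcomp (edge_path x) (edge_path y).
Proof.
case: p => v s w /= E; move: w; rewrite E => -[xv [yx w]].
by split=> //; apply: gpath_eqP; rewrite ?prng_pcomp // pseq_pcomp.
Qed.

(** Generators relate only paths of length at least 2, and the factors of a short path are short, so
    every rule that produces a short path reduces to equality. *)
Lemma gen_cong_short S :
  (forall s t, S s t -> (1 < size s)%N && (1 < size t)%N) ->
  forall p q, gen_cong S p q ->
  (size (pseq p) < 2)%N || (size (pseq q) < 2)%N -> p = q.
Proof.
move=> S2 p q; elim=> {p q} [p q /S2/andP[p2 q2]|//|p q _ IH|p q r _ IH1 _ IH2
  |p p' q q' pq pq' _ IH1 _ IH2].
- by rewrite ltnNge p2 ltnNge q2.
- by rewrite orbC => /IH.
- case/orP=> h.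
  + by have pq := IH1 (introT orP (or_introl h)); rewrite pq in h *;
      apply: IH2; rewrite h.
  + by have qr := IH2 (introT orP (or_intror h)); rewrite -qr in h *;
      apply: IH1; rewrite h orbT.
- rewrite !pseq_pcomp // !size_cat => H.
  have -> : p = p'.
    by apply: IH1; case/orP: H => /(leq_ltn_trans (leq_addr _ _)) ->; rewrite ?orbT.
  have -> // : q = q'.
  by apply: IH2; case/orP: H => /(leq_ltn_trans (leq_addl _ _)) ->; rewrite ?orbT.
Qed.

Lemma gen_cong_ends S :
    (forall p q, S (pseq p) (pseq q) -> prng p = prng q /\ psrc p = psrc q) ->
  forall p q, gen_cong S p q -> prng p = prng q /\ psrc p = psrc q.
Proof.
move=> Se p q; elim=> {p q} [p q /Se//|//|p q _ []//|p q r _ [-> ->] _ []//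
  |p p' q q' pq pq' _ [pp' _] _ [_ qq']].
by rewrite !prng_pcomp !psrc_pcomp.
Qed.

End GenCong.

(** Separates the axioms on composition from those on degrees and factorization, so that functors
    into the delayed graph can be handled through its structure as a quotient of a path category. *)
Record is_category k (L : kdata k) : Prop := IsCategory {
  category_src_idm : forall v : vert L, src (idm v) = v;
  category_rng_idm : forall v : vert L, rng (idm v) = v;
  category_src_comp : forall l m : mor L, src l = rng m -> src (comp l m) = src m;
  category_rng_comp : forall l m : mor L, src l = rng m -> rng (comp l m) = rng l;
  category_idl : forall l : mor L, comp (idm (rng l)) l = l;
  category_idr : forall l : mor L, comp l (idm (src l)) = l;
  category_compA : forall l m n : mor L, src l = rng m -> src m = rng n ->
    comp l (comp m n) = comp (comp l m) n
}.

Lemma kgraph_category k (L : kgraph k) : is_category L.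
Proof. by case: L => D []; split. Qed.

Section GenQuotient.
Variables (k : nat) (Q : cgraph k) (S : seq (gedge Q) -> seq (gedge Q) -> Prop).
Hypothesis S_ends : forall p q : gpath Q, S (pseq p) (pseq q) ->
  prng p = prng q /\ psrc p = psrc q.
Local Notation quot := (path_quotient (gen_cong_rel S)).
Local Notation cls := (\pi_{eq_quot (gen_cong_rel S)}).
Implicit Types p q : gpath Q.

Lemma cls_eqP p q : cls p = cls q <-> gen_cong S p q.
Proof. by split=> [/eqmodP/asboolP //|pq]; apply/eqmodP/asboolP. Qed.

Lemma repr_cong p : gen_cong S (repr (cls p)) p.
Proof. by apply/cls_eqP; rewrite reprK. Qed.

Lemma src_cls p : src (cls p : mor quot) = psrc p.
Proof. by have [_] := gen_cong_ends S_ends (repr_cong p). Qed.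

Lemma rng_cls p : rng (cls p : mor quot) = prng p.
Proof. by have [] := gen_cong_ends S_ends (repr_cong p). Qed.

Lemma cls_pcomp p q : psrc p = prng q ->
  cls (pcomp p q) = comp (cls p : mor quot) (cls q).
Proof.
move=> pq; apply/cls_eqP/GenComp => //.
(* The chosen representatives are composable, because congruent paths have the same ends. *)
- by rewrite -[RHS]/(rng (cls q : mor quot)) -[LHS]/(src (cls p : mor quot))
    src_cls rng_cls.
- by apply: GenSym; exact: repr_cong.
- by apply: GenSym; exact: repr_cong.
Qed.

Lemma cls_surj (c : mor quot) : exists p, c = cls p.
Proof. by exists (repr c); rewrite reprK. Qed.

Lemma quot_category : is_category quot.
Proof.
split.
- by move=> v; rewrite src_cls.
- by move=> v; rewrite rng_cls.
- move=> l m; have [[p ->] [q ->]] := (cls_surj l, cls_surj m) => pq.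
  rewrite src_cls rng_cls in pq.
  by rewrite -cls_pcomp // !src_cls psrc_pcomp.
- move=> l m; have [[p ->] [q ->]] := (cls_surj l, cls_surj m) => pq.
  rewrite src_cls rng_cls in pq.
  by rewrite -cls_pcomp // !rng_cls prng_pcomp.
- move=> l; have [p ->] := cls_surj l; rewrite rng_cls.
  rewrite -[idm _]/(cls (pid _)) -cls_pcomp //; congr (cls _).
  by apply: gpath_eqP; rewrite ?prng_pcomp ?pseq_pcomp.
- move=> l; have [p ->] := cls_surj l; rewrite src_cls.
  rewrite -[idm _]/(cls (pid _)) -cls_pcomp //; congr (cls _).
  by apply: gpath_eqP; rewrite ?prng_pcomp ?pseq_pcomp ?cats0.
- move=> l m n; have [[p ->] [q ->]] := (cls_surj l, cls_surj m).
  have [r ->] := cls_surj n => pq qr.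
  rewrite src_cls rng_cls in pq; rewrite src_cls rng_cls in qr.
  by rewrite -!cls_pcomp ?psrc_pcomp ?prng_pcomp // pcompA.
Qed.

End GenQuotient.

(** * Functors on path categories induced by labels of vertices and edges *)

Section Interp.
Variables (k : nat) (L : kdata k) (Q : cgraph k).
Variables (phi0 : gvert Q -> vert L) (phi : gedge Q -> mor L).
Hypothesis src_phi : forall x, src (phi x) = phi0 (gsrc x).
Hypothesis rng_phi : forall x, rng (phi x) = phi0 (grng x).
Hypothesis K : is_category L.
Implicit Types (p q : gpath Q) (v : gvert Q) (s t : seq (gedge Q)).

(** The argument [v] tracks the vertex reached so far, where the empty sequence becomes an
    identity. *)
Fixpoint interp_seq v s : mor L :=
  if s is x :: s' then comp (phi x) (interp_seq (gsrc x) s') else idm (phi0 v).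

Definition interp p : mor L := interp_seq (prng p) (pseq p).

Lemma interp_pid v : interp (pid v) = idm (phi0 v).
Proof. by []. Qed.

Lemma rng_interp p : rng (interp p) = phi0 (prng p).
Proof.
case: p => v s w; rewrite /interp /=.
elim: s v w => [|x s IH] v /=; first by rewrite category_rng_idm.
by move=> [xv w]; rewrite category_rng_comp // ?IH // rng_phi xv.
Qed.

Lemma src_interp p : src (interp p) = phi0 (psrc p).
Proof.
case: p => v s w; rewrite /interp /psrc /=.
elim: s v w => [|x s IH] v /=; first by rewrite category_src_idm.
move=> [xv w]; rewrite category_src_comp // ?IH //.
by rewrite src_phi (rng_interp (GPath w)).
Qed.

Lemma interp_pcomp p q : psrc p = prng q ->
  interp (pcomp p q) = comp (interp p) (interp q).
Proof.
move=> pq; rewrite /interp prng_pcomp pseq_pcomp //.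
case: p pq => v s w; rewrite /psrc /=.
elim: s v w => [|x s IH] v /=.
  by move=> _ ->; rewrite -rng_interp category_idl.
move=> [xv w] sq; rewrite (IH _ w) // category_compA //.
  by rewrite src_phi (rng_interp (GPath w)).
by rewrite rng_interp (src_interp (GPath w)) /psrc /= sq.
Qed.

Lemma interp_edge x : interp (edge_path x) = phi x.
Proof. by rewrite /interp /= -src_phi category_idr. Qed.

Lemma interp_gen_cong S :
    (forall p q, S (pseq p) (pseq q) -> interp p = interp q) ->
  forall p q, gen_cong S p q -> interp p = interp q.
Proof.
move=> SE p q; elim=> {p q} [p q /SE//|//|//|p q r _ -> _ //
  |p p' q q' pq pq' _ pp' _ qq'].
by rewrite !interp_pcomp // pp' qq'.
Qed.

End Interp.

(** * Labels that preserve degrees: paths as factorizations into edges *)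

Section InterpKgraph.
Variables (k : nat) (L : kgraph k) (Q : cgraph k).
Variables (phi0 : gvert Q -> vert L) (phi : gedge Q -> mor L).
Hypothesis src_phi : forall x, src (phi x) = phi0 (gsrc x).
Hypothesis rng_phi : forall x, rng (phi x) = phi0 (grng x).
Let K := kgraphP L.
Let KC := kgraph_category L.
Implicit Types (p q : gpath Q) (v : gvert Q) (s t : seq (gedge Q)).
Local Notation interp_seq := (interp_seq phi0 phi).
Local Notation interp := (interp phi0 phi).
Let rng_interp := rng_interp src_phi rng_phi KC.
Let src_interp := src_interp src_phi rng_phi KC.
Let interp_pcomp := interp_pcomp src_phi rng_phi KC.
Let interp_edge := interp_edge src_phi KC.

Hypothesis deg_phi : forall x, deg (phi x) = gcolor x.

Lemma deg_interp p : deg (interp p) = pdeg p.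
Proof.
case: p => v s w; rewrite -[interp _]/(interp_seq v s) /pdeg /=.
elim: s v w => [|x s IH] v /=; first by rewrite deg_idm // big_nil.
move=> [xv w]; rewrite deg_comp // ?big_cons ?deg_phi ?(IH _ w) //.
by rewrite src_phi (rng_interp (GPath w)).
Qed.

Hypothesis phi0_inj : injective phi0.
Hypothesis phi_inj : injective phi.
Hypothesis phi0_surj : forall v : vert L, exists u, phi0 u = v.
Hypothesis phi_surj : forall l, mors L (@colors k) l -> exists x, phi x = l.
Hypothesis phi_edge : forall x, mors L (@colors k) (phi x).

Lemma gsrc_eq x p : src (phi x) = rng (interp p) -> gsrc x = prng p.
Proof. by rewrite rng_interp src_phi => /phi0_inj. Qed.

(** Factorization splits off one edge at the range and lowers the total degree; a morphism of degree
    0 is an identity. *)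
Lemma interp_surj l : exists p, interp p = l.
Proof.
have [n] := ubnP (\sum_i deg l i); elim: n l => // n IH l ln.
have [/deg0_idm lE|/eqP/ffunP d0] := eqVneq (deg l) 0.
  by have [u uE] := phi0_surj (rng l); exists (pid u); rewrite interp_pid uE.
have [i di] : exists i, deg l i != 0%N.
  apply/existsP; apply: contrapT => /negP; rewrite negb_exists => /forallP H.
  by apply: d0 => i; have := H i; rewrite negbK ffunE => /eqP.
(* The subtraction is truncated, but [deg l i] is positive, so adding [e_ i] gives back [deg l]. *)
pose m : degree k := [ffun j => (deg l j - (j == i))%N].
have dl : deg l = e_ i + m.
  apply/ffunP => j; rewrite !ffunE [in RHS]/GRing.add /= subnKC //.
  by case: eqP => // ->; rewrite lt0n.
have [x [y [dx dy xy lE]]] := factor_ex dl.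
have [p pE] : exists p, interp p = y.
  apply: IH; rewrite dy -ltnS; apply: leq_trans ln; rewrite ltnS.
  rewrite (bigD1 i) //= [in X in (_ < X)%N](bigD1 i) //= -addSn leq_add //.
    by rewrite ffunE eqxx subn1 prednK // lt0n.
  by apply: leq_sum => j _; rewrite ffunE leq_subr.
have [u uE] : exists u, phi u = x by apply: phi_surj; exists i.
exists (pcomp (edge_path u) p).
rewrite interp_pcomp ?interp_edge ?uE ?pE //.
by apply: gsrc_eq; rewrite uE pE.
Qed.

(** If the first edges had the same color, unique factorization would make their labels agree
    pairwise; the condition on degrees keeps the genuine squares. *)
Definition commuting_square s t : Prop := exists x y z u,
  [/\ s = [:: x; y], t = [:: z; u], deg (phi x) <> deg (phi z)
    & sim2 (phi x) (phi y) (phi z) (phi u)].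

Lemma interp_eq_prng p q : interp p = interp q -> prng p = prng q.
Proof. by move=> /(congr1 (@rng _ _)); rewrite !rng_interp => /phi0_inj. Qed.

(** The length of a path is the sum of the coordinates of its degree, as each edge contributes a
    basis vector. *)
Lemma interp_eq_size p q : interp p = interp q -> size (pseq p) = size (pseq q).
Proof.
move=> /(congr1 (@deg _ _)); rewrite !deg_interp => E.
have H (r : gpath Q) : (\sum_i pdeg r i)%N = size (pseq r).
  rewrite /pdeg; elim: (pseq r) => [|x s IH].
    by rewrite big_nil big1 // => i _; rewrite ffunE.
  rewrite big_cons /= -IH -add1n.
  under eq_bigr do rewrite ffunE.
  rewrite [LHS]big_split /=; congr addn.
  rewrite -deg_phi; have [i _ <-] := phi_edge x.
  rewrite (bigD1 i) //= big1 => [|j /negbTE ji]; by rewrite ffunE ?eqxx ?ji.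
by rewrite -H E H.
Qed.

(* Induction on length.  If the first edges [x] and [y] have different colors,
   the common composite factors as [x z r = y z' r] with [x z = y z'] a square,
   and the induction hypothesis applies after [x] and after [y]. *)
Lemma interp_eq_cong p q : interp p = interp q -> gen_cong commuting_square p q.
Proof.
have [n] := ubnP (size (pseq p)); elim: n p q => // n IH p q pn E.
have Er := interp_eq_prng E; have Es := interp_eq_size E.
case Ep : (pseq p) => [|x s].
  suff -> : p = q by exact: GenRefl.
  apply: gpath_eqP => //; apply/esym.
  by rewrite Ep; apply: size0nil; rewrite -Es Ep.
case Eq : (pseq q) => [|y t]; first by move: Es; rewrite Ep Eq.
have [p' [p's p'x pE]] := gpath_cons Ep.
have [q' [q't q'y qE]] := gpath_cons Eq.
have p'n : (size (pseq p') < n)%N.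
  by rewrite p's -ltnS; apply: leq_trans pn; rewrite Ep.
have E' : comp (phi x) (interp p') = comp (phi y) (interp q').
  by rewrite -!interp_edge -!interp_pcomp // -pE -qE.
have xp' : src (phi x) = rng (interp p') by rewrite src_phi rng_interp p'x.
have yq' : src (phi y) = rng (interp q') by rewrite src_phi rng_interp q'y.
have [dxy|dxy] := pselect (deg (phi x) = deg (phi y)).
  have [/phi_inj xy pq'] := factor_inj xp' yq' dxy E'.
  rewrite pE qE -xy; apply: GenComp => //; first by rewrite /= /psrc /= xy.
    exact: GenRefl.
  exact: IH.
have [i _ xi] := phi_edge x; have [j _ yj] := phi_edge y.
have ij : i != j by apply/eqP => ij; apply: dxy; rewrite -xi -yj ij.
have D : deg (phi x) + deg (interp p') = deg (phi y) + deg (interp q').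
  by rewrite -!deg_comp // E'.
(* Since [i != j], comparing both sides of [D] at coordinate [j] shows that color [j] occurs in
   [interp p']; the truncated subtraction is thus exact. *)
pose m : degree k := [ffun u => (deg (interp p') u - (u == j))%N].
have dm : deg (interp p') = e_ j + m.
  apply/ffunP => u; rewrite !ffunE [in RHS]/GRing.add /= subnKC //.
  case: eqP => // ->; move/ffunP/(_ j): D; rewrite -xi -yj !ffunE eqxx.
  by rewrite eq_sym (negbTE ij) => D; rewrite [X in (_ <= X)%N]D.
have [z [r [dz dr zr p'E]]] := factor_ex dm.
have xz : src (phi x) = rng z by rewrite xp' p'E rng_comp.
have dxz : deg (comp (phi x) z) = e_ j + e_ i.
  by rewrite deg_comp // -xi dz addrC.
have [y' [z' [dy' dz' y'z' xzE]]] := factor_ex dxz.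
have z'r : src z' = rng r.
  by rewrite -zr -(src_comp K xz) xzE src_comp.
have E2 : comp y' (comp z' r) = comp (phi y) (interp q').
  by rewrite -E' p'E !compA // xzE.
have [y'E q'E] : y' = phi y /\ comp z' r = interp q'.
  by apply: factor_inj => //; rewrite ?rng_comp // dy' -yj.
have [a aE] : exists a, phi a = z by apply: phi_surj; exists j.
have [b bE] : exists b, phi b = z' by apply: phi_surj; exists i.
have [c cE] := interp_surj r.
have ac : gsrc a = prng c by apply: gsrc_eq; rewrite aE cE.
have bc : gsrc b = prng c by apply: gsrc_eq; rewrite bE cE.
have xa : gsrc x = grng a by apply: phi0_inj; rewrite -src_phi -rng_phi aE.
have yb : gsrc y = grng b.
  by apply: phi0_inj; rewrite -src_phi -rng_phi bE -y'E.
pose P := pcomp (pcomp (edge_path x) (edge_path a)) c.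
pose R := pcomp (pcomp (edge_path y) (edge_path b)) c.
have pP : gen_cong commuting_square p P.
  rewrite /P -pcompA // pE; apply: GenComp; rewrite ?prng_pcomp //.
    exact: GenRefl.
  by apply: IH => //; rewrite interp_pcomp // interp_edge aE cE.
have qR : gen_cong commuting_square R q.
  rewrite /R -pcompA // qE; apply: GenComp; rewrite ?prng_pcomp //.
    exact: GenRefl.
  (* Symmetry puts [q'] first; it is as long as [p'], hence within the induction bound. *)
  apply: GenSym; apply: IH; rewrite ?interp_pcomp // ?interp_edge ?bE ?cE //.
  by move: Es p'n; rewrite Ep Eq /= p's q't => -[->].
apply: GenTrans pP (GenTrans _ qR).
apply: GenComp; rewrite ?psrc_pcomp //; last exact: GenRefl.
apply: GenSquare; exists x, a, y, b; split; rewrite ?pseq_pcomp //.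
by split; rewrite ?aE ?bE -?y'E.
Qed.

End InterpKgraph.

(** * The collapse of the delayed graph *)

Section DelayCollapse.
Variables (k : nat) (L : kgraph k.+1) (f : mor L).
Hypothesis deg_f : deg f = e_ ord0.
Local Notation e1 := (e_ (ord0 : 'I_k.+1)).
Local Notation e' i := (e_ (lift ord0 i)).
Local Notation DG := (D_graph deg_f).
Local Notation DL := (delay deg_f).
Local Notation C1 := (C1 f).
Local Notation C_ := (C_ f).
Local Notation cls := (\pi_{eq_quot (gen_cong_rel (Q := DG) (@D_square k L f))}).
Let K := kgraphP L.
Implicit Types (g h : set_type C1) (a b c : mor L) (x y : D_edge f).

(** These name the choices hidden in [D_src] and [D_rng], so that the ends of [New al] are [inr] of
    [new_src al] and [new_rng al] by conversion. *)
Definition new_src i (al : set_type (C_ i)) : set_type C1 :=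
  sval (cid (C_source deg_f al)).
Definition new_rng i (al : set_type (C_ i)) : set_type C1 :=
  sval (cid (C_range al)).
Definition new_edge i (al : set_type (C_ i)) : mor L :=
  sval (cid (svalP (cid (C_range al)))).

Lemma C1_deg_val g : deg (val g) = e1.
Proof. exact: C1_deg deg_f _ (set_valP g). Qed.

Lemma new_rngP i (al : set_type (C_ i)) :
  [/\ deg (new_edge al) = e' i, src (val (new_rng al)) = rng (new_edge al)
    & val al = comp (val (new_rng al)) (new_edge al)].
Proof. exact: svalP (cid (svalP (cid (C_range al)))). Qed.

Lemma new_srcP i (al : set_type (C_ i)) : exists b,
  [/\ deg b = e' i, src b = rng (val (new_src al))
    & val al = comp b (val (new_src al))].
Proof. exact: svalP (cid (C_source deg_f al)). Qed.

(** Unique factorization makes the choice immaterial: elements of [C1] all have color e_1, so any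
    such factorization is the chosen one. *)
Lemma new_rngE i (al : set_type (C_ i)) h a : src (val h) = rng a ->
  val al = comp (val h) a -> new_rng al = h /\ new_edge al = a.
Proof.
move=> ha alE; have [_ ha' alE'] := new_rngP al.
have [] := factor_inj ha' ha _ (etrans (esym alE') alE).
  by rewrite !C1_deg_val.
by move=> /val_inj.
Qed.

Lemma new_srcE i (al : set_type (C_ i)) g b : deg b = e' i ->
  src b = rng (val g) -> val al = comp b (val g) -> new_src al = g.
Proof.
move=> db bg alE; have [b' [db' bg' alE']] := new_srcP al.
have [] := factor_inj bg' bg _ (etrans (esym alE') alE).
  by rewrite db db'.
by move=> _ /val_inj.
Qed.

Lemma new_edge_src i (al : set_type (C_ i)) :
  src (new_edge al) = src (val (new_src al)).
Proof.
have [_ ha alE] := new_rngP al; have [b [_ bg alE']] := new_srcP al.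
by rewrite -(src_comp K ha) -alE alE' src_comp.
Qed.

Definition collapse_vert (v : D_vert f) : vert L :=
  match v with inl v => v | inr g => src (val g) end.

Definition collapse_edge x : mor L :=
  match x with
  | Old a => val a
  | Fst g => idm (src (val g))
  | Snd g => val g
  | New i al => new_edge al
  end.

Lemma src_collapse x :
  src (collapse_edge x) = collapse_vert (D_src deg_f x).
Proof. by case: x => //= [g|i al]; rewrite ?src_idm // new_edge_src. Qed.

Lemma rng_collapse x : rng (collapse_edge x) = collapse_vert (D_rng x).
Proof.
case: x => //= [g|i al]; first by rewrite rng_idm.
by have [_ <-] := new_rngP al.
Qed.

Local Notation collapse_path := (interp (Q := DG) collapse_vert collapse_edge).

(** A square of case 1 is kept, the two halves of case 2 become bg = ha and the trivial equation a =
    a, and case 3 becomes the face c' a = a' c'' of the cube. Equality of the ends needs the whole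
    cube only in case 3. *)
Lemma D_square_collapse (p q : gpath DG) : D_square (pseq p) (pseq q) ->
  [/\ prng p = prng q, psrc p = psrc q & collapse_path p = collapse_path q].
Proof.
case: p q => v s w [v' t w']; rewrite /interp /psrc /= => S.
case: S w w' => {s t}
  [x y z t _ _ [xy zt E]
  |i g h a b al da db [bg ha E] alE
  |i g h a b al da db [bg ha E] alE
  |i j al ga be de g h g1 a a' b' c c' c'' _ da gal alE dc dc' [cg hc' cgE] beE
    da' dc'' [c'a a'c'' c'aE] db' [ha' bg1 ha'E] gaE deE] /= [<- [xy' _]] [<- [zt' _]].
- split; last by rewrite !comp_idr.
    by rewrite -(rng_comp K xy) E rng_comp.
  by rewrite -(src_comp K xy) E src_comp.
- have [_ aE] := new_rngE ha (etrans alE E).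
  have gE := new_srcE db bg alE; rewrite -/(new_src al) gE aE.
  have sE : src (val a) = src (val g) by rewrite -aE new_edge_src gE.
  split=> //; first by rewrite -(rng_comp K bg) E rng_comp.
  by rewrite -{2}sE !comp_idr.
- have [hE aE] := new_rngE ha (etrans alE E).
  have sE : src (val a) = src (val g).
    by rewrite -(src_comp K bg) E src_comp.
  have idmK (u : vert L) : comp (idm u) (idm u) = idm u.
    by rewrite -{1}(rng_idm K u) comp_idl.
  rewrite -/(new_rng al) hE aE sE; split=> //.
  by rewrite idmK -sE !comp_idr // ha comp_idl.
- have [alg ala] := new_rngE gal alE.
  have [beh bec'] := new_rngE hc' (etrans beE cgE).
  have [gah gaa'] := new_rngE ha' gaE.
  have g1c'' : src (val g1) = rng c''.
    by rewrite -a'c'' -(src_comp K ha') ha'E src_comp.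
  have [deg1 dec''] := new_rngE g1c'' deE.
  have [b0 [db0 b0g alE']] := new_srcP al.
  have [c0 [dc0 c0g deE']] := new_srcP de.
  rewrite -/(new_rng be) -/(new_rng ga) -/(new_src al) -/(new_src de).
  have cb0 : src c = rng b0.
    by rewrite -(rng_comp K b0g) -alE' alE rng_comp.
  have b'c0 : src b' = rng c0.
    by rewrite -(rng_comp K c0g) -deE' deE rng_comp.
  (* Both sides are c g a = h c' a = h a' c'' = b' g1 c''. *)
  have cube : comp (comp c b0) (val (new_src al))
            = comp (comp b' c0) (val (new_src de)).
    rewrite -compA // -alE' -[RHS]compA // -deE' alE deE.
    rewrite compA // cgE -compA // ?c'a // c'aE.
    by rewrite [LHS]compA // ha'E -compA.
  (* Both are the last factor, of color e_1, of the diagonal of the cube; the prefixes [c b0] and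
     [b' c0] have the same degree, with the two colors in opposite orders. *)
  have srcE : new_src al = new_src de.
    have [|||_ /val_inj //] := factor_inj _ _ _ cube; rewrite ?src_comp //.
    by rewrite !deg_comp // dc db0 db' dc0 addrC.
  rewrite beh bec' gah gaa' dec'' ala srcE; split=> //.
  have sa : src a = src (val (new_src de)) by rewrite -ala new_edge_src srcE.
  have sc : src c'' = src (val (new_src de)) by rewrite -dec'' new_edge_src.
  by rewrite -{1}sa -sc !comp_idr.
Qed.

Let collapse_cat := kgraph_category L.

Lemma D_ends (p q : gpath DG) : D_square (pseq p) (pseq q) ->
  prng p = prng q /\ psrc p = psrc q.
Proof. by case/D_square_collapse. Qed.

Definition collapse (c : mor DL) : mor L := collapse_path (repr c).

Lemma collapse_cls (p : gpath DG) : collapse (cls p) = collapse_path p.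
Proof.
have H := interp_gen_cong (Q := DG) src_collapse rng_collapse collapse_cat.
apply: (H _ _ _ _ (repr_cong _ p)).
by move=> q r /D_square_collapse[].
Qed.

Lemma src_delay (p : gpath DG) : src (cls p : mor DL) = psrc p.
Proof. exact: src_cls D_ends p. Qed.

Lemma rng_delay (p : gpath DG) : rng (cls p : mor DL) = prng p.
Proof. exact: rng_cls D_ends p. Qed.

Lemma collapse_comp (c d : mor DL) : src c = rng d ->
  collapse (comp c d) = comp (collapse c) (collapse d).
Proof.
rewrite -[c]reprK -[d]reprK; move: (repr c) (repr d) => p q.
rewrite src_delay rng_delay => pq.
rewrite -(cls_pcomp D_ends) // !collapse_cls.
exact: (interp_pcomp (Q := DG) src_collapse rng_collapse collapse_cat pq).
Qed.

Definition delay_mor x : mor DL := cls (edge_path (x : gedge DG)).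

(** Both sides of every square have two edges, so a single edge is alone in its class. *)
Lemma repr_delay_mor x : repr (delay_mor x) = edge_path (x : gedge DG).
Proof.
have D2 s t : @D_square k L f s t -> (1 < size s)%N && (1 < size t)%N by case.
by apply: (gen_cong_short (Q := DG) D2 (repr_cong (Q := DG) _ _)); rewrite orbT.
Qed.

Lemma src_delay_mor x : src (delay_mor x) = D_src deg_f x.
Proof. exact: src_delay. Qed.

Lemma rng_delay_mor x : rng (delay_mor x) = D_rng x.
Proof. exact: rng_delay. Qed.

Lemma deg_delay_mor x : deg (delay_mor x) = D_color x.
Proof. by rewrite /deg /= repr_delay_mor /pdeg big_seq1. Qed.

Lemma collapse_delay_mor x : collapse (delay_mor x) = collapse_edge x.
Proof.
rewrite collapse_cls.
exact: (interp_edge (Q := DG) src_collapse collapse_cat x).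
Qed.

Lemma delay_mor_square x y z t : D_src deg_f x = D_rng y ->
  D_src deg_f z = D_rng t -> D_square [:: x; y] [:: z; t] ->
  comp (delay_mor x) (delay_mor y) = comp (delay_mor z) (delay_mor t).
Proof.
move=> xy zt S; rewrite -!(cls_pcomp D_ends) //; apply/cls_eqP/GenSquare.
by rewrite !pseq_pcomp.
Qed.

Let delay_cat : is_category DL := quot_category D_ends.

(** The two halves of case 2 are used in turn, with al = bg: b g^2 g^1 = h^2 e_al g^1 = h^2 h^1
    a. *)
Lemma delay_snd_fst (i : 'I_k) g h (a b : D_old f) :
    deg (val a) = e' i -> deg (val b) = e' i ->
    sim2 (val b) (val g) (val h) (val a) ->
  comp (delay_mor (Old b)) (comp (delay_mor (Snd g)) (delay_mor (Fst g)))
  = comp (comp (delay_mor (Snd h)) (delay_mor (Fst h))) (delay_mor (Old a)).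
Proof.
move=> da db S; have [bg ha E] := S.
have Cal : C_ i (comp (val b) (val g)).
  by exists (val h), (val a); split=> //; exact: set_valP.
pose al : set_type (C_ i) := SigSub (mem_set Cal).
have alE : val al = comp (val b) (val g) by [].
have alh : new_rng al = h by have [] := new_rngE ha (etrans alE E).
have alg : new_src al = g by apply: new_srcE bg _.
have sa : src (val a) = src (val g) by rewrite -(src_comp K bg) E src_comp.
have D_alh : D_rng (New al) = inr h by rewrite -alh.
have D_alg : D_src deg_f (New al) = inr g by rewrite -alg.
have bg' : D_src deg_f (Old b) = D_rng (Snd g) by rewrite /= bg.
have ha' : D_src deg_f (Fst h) = D_rng (Old a) by rewrite /= ha.
rewrite (category_compA delay_cat) ?src_delay_mor ?rng_delay_mor //.
rewrite (@delay_mor_square _ _ (Snd h) (New al)) //; last first.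
  exact: D_case2_snd da db S alE.
rewrite -(category_compA delay_cat) ?src_delay_mor ?rng_delay_mor //.
rewrite (@delay_mor_square _ _ (Fst h) (Old a)) //; last first.
  exact: D_case2_fst da db S alE.
by rewrite (category_compA delay_cat) ?src_delay_mor ?rng_delay_mor.
Qed.

(** * The reduction at [v_f] *)

Local Notation B1 := ([set e1] : set (degree k.+1)).
Local Notation U := (nbhd_vert (v_f deg_f) B1).

Lemma new_adjacent i (al : set_type (C_ i)) :
  adjacent B1 (inr (new_src al) : vert DL) (inr (new_rng al)).
Proof.
exists (delay_mor (New al)); last by rewrite src_delay_mor rng_delay_mor.
rewrite /mors /= -[pdeg _]/(deg (delay_mor (New al))) deg_delay_mor.
by split; [exists (lift ord0 i)|move=> /eqP; rewrite /= e'_neq].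
Qed.

(** If [g] and [h] are opposite sides of a square with composite al, then e_al joins [v_g] and
    [v_h]. Its direction depends on the side on which [g] lies, which is harmless as components are
    undirected. *)
Lemma across_nbhd g h : across (val g) (val h) ->
  U (inr g : vert DL) -> U (inr h : vert DL).
Proof.
case=> i [a [b [da db [] S]]] Ug; have [ag hb E] := S.
- have Cal : C_ i (comp a (val g)).
    by exists (val h), b; split=> //; exact: set_valP.
  have := new_adjacent (SigSub (mem_set Cal)).
  have -> : new_src (SigSub (mem_set Cal)) = g by apply: new_srcE ag _.
  have [-> _] : new_rng (SigSub (mem_set Cal)) = h /\ new_edge (SigSub (mem_set Cal)) = b.
    exact: new_rngE.
  by move=> gh; apply: rst_trans Ug _; exact: rst_step.
- have Cal : C_ i (comp (val g) a).
    by exists (val g), a; split=> //; exact: set_valP.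
  have := new_adjacent (SigSub (mem_set Cal)).
  have -> : new_src (SigSub (mem_set Cal)) = h by apply: new_srcE hb _.
  have [-> _] : new_rng (SigSub (mem_set Cal)) = g /\ new_edge (SigSub (mem_set Cal)) = a.
    exact: new_rngE.
  by move=> gh; apply: rst_trans Ug _; apply: rst_sym; exact: rst_step.
Qed.

(** [C1] is generated from [f] by crossing squares, and each crossing moves along an edge e_al of
    color other than e_1. *)
Lemma nbhd_inr g : U (inr g : vert DL).
Proof.
have Uf : U (inr (SigSub (mem_set (C1_f f))) : vert DL) by exact: rst_refl.
suff H m h : A_ f m (val h) -> U (inr h : vert DL).
  by have [m _ /H] := set_valP g.
elim: m h => [|m IH] h /= => [[hf|[_ hf]]|[_ [h' Ah' h'h]]].
- by have -> : h = SigSub (mem_set (C1_f f)) by exact: val_inj.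
(* Here [across] leads from [h] to [f], so the same square is read in the other direction. *)
- case: hf => i [a [b [da db S]]].
  apply: across_nbhd Uf; exists i, b, a; split=> //.
  by case: S => -[? ? E]; [right|left].
- have Ch' : C1 h' by exists m.
  exact: (@across_nbhd (SigSub (mem_set Ch')) h h'h (IH (SigSub (mem_set Ch')) Ah')).
Qed.

Lemma nbhd_inl (v : vert L) : ~ U (inl v : vert DL).
Proof. by move/nbhd_new. Qed.

(** * Vertices and edges of the reduction, matched with those of [L] *)

Local Notation RG :=
  (@R_graph k.+1 DL (v_f deg_f) B1 (HR_delay deg_f) e1 erefl).
Implicit Types (m : gedge RG) (u : gvert RG).

(** The reduction removes [g^1], which enters [v_g] with color e_1, and each e_al, whose ends both
    lie in the neighborhood. *)
Lemma R_edgeP m : (exists a : D_old f, val m = delay_mor (Old a))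
  \/ (exists g, val m = delay_mor (Snd g)).
Proof.
have [mE mN] := set_valP m.
have [x [sx dx rx sx']] := delay_edge mE.
have mx : val m = delay_mor x.
  rewrite -[val m]reprK; congr \pi; apply: gpath_eqP; last exact: sx.
  exact: rx.
case: x mx {sx dx rx sx'} => [a|g|g|i al] mx; first by left; exists a.
- case: mN; right; exists (inr g); first exact: nbhd_inr.
  by rewrite mx; split; [exact: deg_delay_mor | exact: rng_delay_mor].
- by right; exists g.
- case: mN; left; split; last first.
    have Us : U (src (delay_mor (New al))).
      by rewrite src_delay_mor; exact: nbhd_inr.
    have Ur : U (rng (delay_mor (New al))).
      by rewrite rng_delay_mor; exact: nbhd_inr.
    by rewrite mx.
  split=> // dm; have : e' i == e1 by rewrite -dm mx deg_delay_mor.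
  by rewrite e'_neq.
Qed.

Lemma R_edge_ex x v : D_rng x = inl v -> exists m, val m = delay_mor x.
Proof.
move=> xv.
have H : (mors DL (@colors k.+1) `\`
    (nbhd_edge (v_f deg_f) B1 `|` \bigcup_(y in U) into y B1)) (delay_mor x).
  split.
    have [i xi] := D_color_e x; exists i => //.
    by rewrite -xi; apply/esym; exact: deg_delay_mor.
  have nU : ~ U (rng (delay_mor x)) by rewrite rng_delay_mor xv; exact: nbhd_inl.
  by case=> [[_ []] //|[y Uy [_ /= ry]]]; apply: nU; rewrite [rng _]ry.
by exists (SigSub (mem_set H)).
Qed.

Definition collapse_R_vert u : vert L := collapse_vert (val u).
Definition collapse_R_edge m : mor L := collapse (val m).

(** The reduction moves the source of [g^2] from [v_g] to the source of [g^1], which is s(g); the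
    sources of old edges stay in place. *)
Lemma src_collapse_R m : src (collapse_R_edge m) = collapse_R_vert (gsrc m).
Proof.
rewrite /collapse_R_edge /collapse_R_vert.
rewrite -[gsrc m]/(R_src (HR_delay deg_f) (b := e1) erefl m) /R_src.
case: pselect => [Us|nU]; rewrite SubK.
  have [[a ma]|[g mg]] := R_edgeP m.
    by have := Us; rewrite {1}ma src_delay_mor => /nbhd_inl.
  have sm : src (val m) = inr g by rewrite mg src_delay_mor.
  (* The edge chosen by [f_] must be [g^1], the only edge of color e_1 entering [v_g]. *)
  have fE : f_ (HR_delay deg_f) erefl Us = fst_mor deg_f g.
    by apply: edge_into_v; rewrite -sm; exact: f_P.
  by rewrite fE fst_src mg collapse_delay_mor.
have [[x mx]|[x mx]] := R_edgeP m;
  by rewrite mx src_delay_mor collapse_delay_mor src_collapse.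
Qed.

Lemma rng_collapse_R m : rng (collapse_R_edge m) = collapse_R_vert (grng m).
Proof.
rewrite /collapse_R_edge /collapse_R_vert -[val (grng m)]/(rng (val m)).
have [[x mx]|[x mx]] := R_edgeP m;
  by rewrite mx rng_delay_mor collapse_delay_mor rng_collapse.
Qed.

Lemma deg_collapse_R m : deg (collapse_R_edge m) = gcolor m.
Proof.
rewrite /collapse_R_edge -[gcolor m]/(deg (val m)).
have [[x mx]|[x mx]] := R_edgeP m; rewrite mx deg_delay_mor collapse_delay_mor //.
exact: C1_deg_val.
Qed.

Lemma R_vertP u : exists v, val u = inl v.
Proof.
have := set_valP u; case: (val u) => [v|g] /= nU; first by exists v.
by case: nU; exact: nbhd_inr.
Qed.

Lemma collapse_R_vert_inj : injective collapse_R_vert.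
Proof.
move=> u u'; rewrite /collapse_R_vert.
have [[v uv] [v' uv']] := (R_vertP u, R_vertP u').
by rewrite uv uv' => /= vv; apply: val_inj; rewrite uv uv' vv.
Qed.

Lemma collapse_R_vert_surj (v : vert L) : exists u, collapse_R_vert u = v.
Proof.
have nU : (~` U) (inl v : vert DL) by exact: nbhd_inl.
by exists (SigSub (mem_set nU)).
Qed.

Lemma collapse_R_edge_inj : injective collapse_R_edge.
Proof.
move=> m m'; rewrite /collapse_R_edge => E; apply: val_inj.
have [[a ma]|[g mg]] := R_edgeP m; have [[a' ma']|[g' mg']] := R_edgeP m'.
- by move: E; rewrite ma ma' !collapse_delay_mor => /val_inj ->.
- move: E; rewrite ma mg' !collapse_delay_mor /= => E.
  by have [_] := set_valP a; case; rewrite [_ a]E; exact: set_valP.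
- move: E; rewrite mg ma' !collapse_delay_mor /= => E.
  by have [_] := set_valP a'; case; rewrite -[_ a']E; exact: set_valP.
- by move: E; rewrite mg mg' !collapse_delay_mor => /val_inj ->.
Qed.

Lemma collapse_R_edge_surj l : mors L (@colors k.+1) l ->
  exists m, collapse_R_edge m = l.
Proof.
move=> lE; have [Cl|nCl] := pselect (C1 l).
  have [m mE] := R_edge_ex (x := Snd (SigSub (mem_set Cl))) erefl.
  by exists m; rewrite /collapse_R_edge mE collapse_delay_mor.
have H : (mors L (@colors k.+1) `\` C1) l by split.
have [m mE] := R_edge_ex (x := Old (SigSub (mem_set H))) erefl.
by exists m; rewrite /collapse_R_edge mE collapse_delay_mor.
Qed.

Lemma collapse_R_edge_color m : mors L (@colors k.+1) (collapse_R_edge m).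
Proof.
have [[x mx]|[x mx]] := R_edgeP m;
  rewrite /collapse_R_edge mx collapse_delay_mor /=; first by have [] := set_valP x.
by rewrite /mors /= C1_deg_val; exists ord0.
Qed.

(** * The map par and its composition with the collapse *)

Local Notation pare := (par_edge (HR_delay deg_f) (b := e1) erefl).

(** par completes [g^2] to [g^2 g^1], the delayed form of [g], and leaves old edges unchanged. *)
Lemma par_edgeP m :
  (exists a : D_old f, collapse_R_edge m = val a /\ pare m = delay_mor (Old a))
  \/ (exists g, collapse_R_edge m = val g /\
        pare m = comp (delay_mor (Snd g)) (delay_mor (Fst g))).
Proof.
rewrite /collapse_R_edge /par_edge; case: pselect => [Us|nU].
  have [[a ma]|[g mg]] := R_edgeP m.
    by have := Us; rewrite {1}ma src_delay_mor => /nbhd_inl.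
  have sm : src (val m) = inr g by rewrite mg src_delay_mor.
  have fE : f_ (HR_delay deg_f) erefl Us = delay_mor (Fst g).
    by apply: edge_into_v; rewrite -sm; exact: f_P.
  by right; exists g; rewrite fE mg collapse_delay_mor.
have [[a ma]|[g mg]] := R_edgeP m.
  by left; exists a; rewrite ma collapse_delay_mor.
by case: nU; rewrite mg src_delay_mor; exact: nbhd_inr.
Qed.

Lemma src_par_edge m : src (pare m) = val (gsrc m).
Proof.
rewrite -[gsrc m]/(R_src (HR_delay deg_f) (b := e1) erefl m) /par_edge /R_src.
case: pselect => [Us|nU]; rewrite SubK //.
by rewrite (category_src_comp delay_cat) //;
  have [_] := f_P (HR_delay deg_f) (b := e1) erefl Us.
Qed.

Lemma rng_par_edge m : rng (pare m) = val (grng m).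
Proof.
rewrite -[val (grng m)]/(rng (val m)) /par_edge.
case: pselect => [Us|nU] //.
by rewrite (category_rng_comp delay_cat) //;
  have [_] := f_P (HR_delay deg_f) (b := e1) erefl Us.
Qed.

Lemma collapse_par_edge m : collapse (pare m) = collapse_R_edge m.
Proof.
have [[a [-> ->]]|[g [-> ->]]] := par_edgeP m; first exact: collapse_delay_mor.
rewrite collapse_comp ?src_delay_mor ?rng_delay_mor // !collapse_delay_mor /=.
by rewrite comp_idr.
Qed.

Local Notation par_interp := (interp (Q := RG) (L := DL) (fun u => val u) pare).

Lemma parE (p : gpath RG) : par p = par_interp p.
Proof.
case: p => v s w; rewrite /par /interp /psrc /=.
by elim: s v {w} => [|m s IH] v //=; rewrite -IH.
Qed.

Local Notation collapse_R := (interp (Q := RG) collapse_R_vert collapse_R_edge).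

Lemma collapse_par (p : gpath RG) : collapse (par p) = collapse_R p.
Proof.
rewrite parE; case: p => v s w; rewrite /interp /=.
elim: s v w => [|m s IH] v /=; first by rewrite collapse_cls interp_pid.
move=> [mv w]; rewrite collapse_comp ?(IH _ w) ?collapse_par_edge //.
rewrite src_par_edge.
by rewrite (rng_interp (Q := RG) src_par_edge rng_par_edge delay_cat (GPath w)).
Qed.

(** * Squares of [L] under par *)

Lemma par_edge_C1 m : C1 (collapse_R_edge m) ->
  exists g, collapse_R_edge m = val g /\
    pare m = comp (delay_mor (Snd g)) (delay_mor (Fst g)).
Proof.
by case: (par_edgeP m) => [[a [-> _]] Ca|//]; have [_] := set_valP a.
Qed.

Lemma par_edge_old m : ~ C1 (collapse_R_edge m) ->
  exists a : D_old f, collapse_R_edge m = val a /\ pare m = delay_mor (Old a).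
Proof.
by case: (par_edgeP m) => [//|[g [-> _]] nC]; case: nC; exact: set_valP.
Qed.

Lemma C1_square i (l1 l2 l3 l4 : mor L) : deg l1 = e1 -> deg l4 = e1 ->
  deg l2 = e' i -> deg l3 = e' i -> sim2 l1 l2 l3 l4 -> C1 l1 <-> C1 l4.
Proof.
move=> d1 d4 d2 d3 S; have [l12 l34 E] := S; split=> Cl.
  by apply: C1_across Cl _ d4; exists i, l2, l3; split=> //; right.
by apply: C1_across Cl _ d1; exists i, l3, l2; split=> //; left.
Qed.

Lemma e'_notC1 i l : deg l = e' i -> ~ C1 l.
Proof. by move=> dl /(C1_deg deg_f)/eqP; rewrite dl e'_neq. Qed.

Section Square.
Variables m1 m2 m3 m4 : gedge RG.
Local Notation l1 := (collapse_R_edge m1).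
Local Notation l2 := (collapse_R_edge m2).
Local Notation l3 := (collapse_R_edge m3).
Local Notation l4 := (collapse_R_edge m4).

Lemma par_square_old : ~ C1 l1 -> ~ C1 l2 -> ~ C1 l3 -> ~ C1 l4 ->
  deg l1 <> deg l2 -> deg l3 <> deg l4 -> sim2 l1 l2 l3 l4 ->
  comp (pare m1) (pare m2) = comp (pare m3) (pare m4).
Proof.
move=> /par_edge_old[a1 [-> ->]] /par_edge_old[a2 [-> ->]].
move=> /par_edge_old[a3 [-> ->]] /par_edge_old[a4 [-> ->]] d12 d34 S.
have [a12 a34 _] := S.
by apply: delay_mor_square => /=; rewrite ?a12 ?a34 //; exact: D_case1.
Qed.

(** The two opposite sides of color e_1 lie in [C1] together or not at all: in the first case
    [delay_snd_fst] applies, in the second all four edges are old. *)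
Lemma par_square_e1 i : deg l1 = e1 -> deg l4 = e1 ->
  deg l2 = e' i -> deg l3 = e' i -> sim2 l1 l2 l3 l4 ->
  comp (pare m1) (pare m2) = comp (pare m3) (pare m4).
Proof.
move=> d1 d4 d2 d3 S; have C14 := C1_square d1 d4 d2 d3 S.
have [C2 C3] := (e'_notC1 d2, e'_notC1 d3).
have [C|C] := pselect (C1 l1); last first.
  apply: par_square_old => //; first by rewrite -C14.
    by rewrite d1 d2 => /eqP; rewrite eq_sym e'_neq.
  by rewrite d3 d4 => /eqP; rewrite e'_neq.
move: S d2 d3; have [h [-> ->]] := par_edge_C1 C.
have [g [-> ->]] := par_edge_C1 (C14.1 C).
have [a [-> ->]] := par_edge_old C2; have [b [-> ->]] := par_edge_old C3.
by move=> [ha bg E] da db; apply/esym; apply: delay_snd_fst da db _.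
Qed.
End Square.

Lemma e_add_swap (n : nat) (i j r s : 'I_n) :
  e_ i + e_ r = e_ j + e_ s -> i != j -> r = j /\ s = i.
Proof.
move=> /ffunP E ij; have := E i; have := E j; rewrite !ffunE !eqxx.
rewrite (negbTE ij) eq_sym (negbTE ij).
by case: (j =P r) => [->|_]; case: (i =P s) => [->|_] //; case: eqP; case: eqP.
Qed.

Lemma par_square m1 m2 m3 m4 :
  deg (collapse_R_edge m1) <> deg (collapse_R_edge m3) ->
  sim2 (collapse_R_edge m1) (collapse_R_edge m2)
       (collapse_R_edge m3) (collapse_R_edge m4) ->
  comp (pare m1) (pare m2) = comp (pare m3) (pare m4).
Proof.
move=> d13 S; have [l12 l34 E] := S.
have [i _ d1] := collapse_R_edge_color m1.
have [r _ d2] := collapse_R_edge_color m2.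
have [j _ d3] := collapse_R_edge_color m3.
have [s _ d4] := collapse_R_edge_color m4.
have ij : i != j by apply/eqP => ij; apply: d13; rewrite -d1 -d3 ij.
have : deg (comp (collapse_R_edge m1) (collapse_R_edge m2))
  = deg (comp (collapse_R_edge m3) (collapse_R_edge m4)) by rewrite E.
rewrite !deg_comp // -d1 -d2 -d3 -d4 => /e_add_swap/(_ ij)[rj si].
rewrite {}rj in d2; rewrite {}si in d4.
(* At most one of the two colors is e_1. If neither is, no side of the square lies in [C1] and case
   1 applies. *)
have [i' iE|i0] := unliftP ord0 i; have [j' jE|j0] := unliftP ord0 j.
- rewrite iE in d1 d4; rewrite jE in d2 d3.
  apply: par_square_old; rewrite // -?d1 -?d2 -?d3 -?d4.
  + exact: e'_notC1 (esym d1).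
  + exact: e'_notC1 (esym d2).
  + exact: e'_notC1 (esym d3).
  + exact: e'_notC1 (esym d4).
  + by move/e_inj => ijE; rewrite iE jE ijE eqxx in ij.
  + by move/e_inj => ijE; rewrite iE jE ijE eqxx in ij.
- rewrite iE in d1 d4; rewrite j0 in d2 d3.
  by apply/esym; apply: (@par_square_e1 m3 m4 m1 m2 i').
- rewrite i0 in d1 d4; rewrite jE in d2 d3.
  exact: (@par_square_e1 m1 m2 m3 m4 j').
- by rewrite i0 j0 eqxx in ij.
Qed.

(** * Comparison of the relations, and the isomorphism *)

Lemma collapse_R_cong (p q : gpath RG) : collapse_R p = collapse_R q ->
  gen_cong (commuting_square collapse_R_edge) p q.
Proof.
exact: (interp_eq_cong (Q := RG) src_collapse_R rng_collapse_R deg_collapse_R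
  collapse_R_vert_inj collapse_R_edge_inj collapse_R_vert_surj
  collapse_R_edge_surj collapse_R_edge_color).
Qed.

Lemma par_collapse_R (p q : gpath RG) :
  collapse_R p = collapse_R q -> par p = par q.
Proof.
move/collapse_R_cong => C; rewrite !parE.
have H := interp_gen_cong (Q := RG) src_par_edge rng_par_edge delay_cat.
apply: H C => {p q} p q [m1 [m2 [m3 [m4 [Ep Eq d S]]]]].
have [m12 ->] := gpath_two Ep; have [m34 ->] := gpath_two Eq.
rewrite !(interp_pcomp (Q := RG) src_par_edge rng_par_edge delay_cat) //.
rewrite !(interp_edge (Q := RG) src_par_edge delay_cat).
exact: par_square.
Qed.

(** Equal composites force equal lengths. If both paths are long, their values under par decide; if
    both are short, [gen_cong_short] gives the equality that [R_sim] demands. *)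
Lemma R_sim_collapse (p q : gpath RG) :
  R_sim p q <-> collapse_R p = collapse_R q.
Proof.
rewrite /R_sim; split=> [|E].
  by case: ifP => _; [rewrite -!collapse_par => -> | move->].
have s := interp_eq_size (Q := RG) src_collapse_R rng_collapse_R deg_collapse_R
  collapse_R_edge_color E.
case: ifP => [_|]; first exact: par_collapse_R.
rewrite s andbb => /negbT; rewrite -leqNgt => q2.
apply: (gen_cong_short (Q := RG) _ (collapse_R_cong E)); last first.
  by rewrite [X in _ || X]q2 orbT.
by move=> _ _ [? [? [? [? [-> -> _ _]]]]].
Qed.

Lemma reduction_iso :
  kgraph_iso (reduction (HR_delay deg_f) (b := e1) erefl) L.
Proof.
set M := reduction _ _.
pose F (c : mor M) : mor L := collapse_R (repr c).
pose pi (p : gpath RG) : mor M :=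
  \pi_{eq_quot (EquivRelPack (R_sim_equiv (HR_delay deg_f) (b := e1) erefl))} p.
(* This one equivalence makes [F] both independent of representatives and injective. *)
have piE p q : pi p = pi q <-> collapse_R p = collapse_R q.
  by rewrite -R_sim_collapse; split=> [/eqmodP/asboolP|?] //; apply/eqmodP/asboolP.
have Fpi p : F (pi p) = collapse_R p by apply/piE; rewrite /pi reprK.
have srcR := src_interp (Q := RG) src_collapse_R rng_collapse_R collapse_cat.
have rngR := rng_interp (Q := RG) src_collapse_R rng_collapse_R collapse_cat.
exists collapse_R_vert, F; split.
- split; rewrite -setTT_bijective; split=> //.
  + by move=> u u' _ _; exact: collapse_R_vert_inj.
  + by move=> v _; have [u <-] := collapse_R_vert_surj v; exists u.
  + by move=> c d _ _ /piE; rewrite /pi !reprK.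
  + move=> l _; have [p <-] := interp_surj (Q := RG) src_collapse_R rng_collapse_R
      collapse_R_vert_inj collapse_R_vert_surj collapse_R_edge_surj l.
    by exists (pi p).
- by split=> c; [exact: srcR | exact: rngR].
- by move=> u; rewrite -[idm u]/(pi (pid u)) Fpi.
- move=> c d cd; rewrite -[comp c d]/(pi (pcomp (repr c) (repr d))) Fpi.
  exact: (interp_pcomp (Q := RG) src_collapse_R rng_collapse_R collapse_cat).
- move=> c.
  exact: (deg_interp (Q := RG) src_collapse_R rng_collapse_R deg_collapse_R).
Qed.

End DelayCollapse.

Theorem proposition6p8 (k : nat) (L : kgraph k.+1) (f : mor L)
    (deg_f : deg f = e_ ord0) :
  kgraph_iso
    (@reduction k.+1 (delay deg_f) (v_f deg_f) [set e_ ord0]%classic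
       (HR_delay deg_f) (e_ ord0) erefl)
    L.
Proof. exact: reduction_iso. Qed.
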